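(* Let $n,w,t$ be integers with $t\le w$ and $t\le 2w-t\le n$, and let $q\ge 3$. Define $$A'_q(n,w,t)=\{(a_1,\dots,a_n)\in\mathbb{Z}_q^n:\ \mathrm{wt}((a_1,\dots,a_t))=t,\ \mathrm{wt}((a_{t+1},\dots,a_n))=w-t\}.$$ Then: (1') $|A'_q(n,w,t)|=\binom{n-t}{w-t}(q-1)^w$; (2') $A'_q(n,w,t)$ is an anticode of diameter $2w-t$ in $J_q(n,w)$; (3') if $n\ge (w-t+1)(t+1)$, then for all sufficiently large $q$, $A'_q(n,w,t)$ is a maximum anticode of diameter $2w-t$ in $J_q(n,w)$ (i.e. no subset of $J_q(n,w)$ of diameter at most $2w-t$ has more elements).
   Context: $\mathbb{Z}_q=\{0,1,\dots,q-1\}$ is used merely as an alphabet. For $x\in\mathbb{Z}_q^n$, $\mathrm{supp}(x)=\{i\in[n]: x_i\ne 0\}$ and $\mathrm{wt}(x)=|\mathrm{supp}(x)|$; $d(x,y)$ is the Hamming distance (number of positions where $x,y$ differ). $J_q(n,w)$ denotes the set of words of $\mathbb{Z}_q^n$ of weight $w$, with the Hamming metric. An anticode of diameter $D$ is a nonempty subset in which all pairwise distances are at most $D$; it is maximum if it has the largest cardinality among all anticodes of diameter $D$ in the space. *)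

(* Defs.v *)
From mathcomp Require Import all_boot.
Set Implicit Arguments. Unset Strict Implicit. Unset Printing Implicit Defensive.

(* Words of Z_q^n: functions 'I_n -> 'I_q (Z_q = {0,...,q-1} used as an alphabet);
   coordinate i (0-based) corresponds to position i+1 of the paper. *)
Definition word (n q : nat) := {ffun 'I_n -> 'I_q}.

Definition supp n q (x : word n q) : {set 'I_n} := [set i | nat_of_ord (x i) != 0].
Definition wt n q (x : word n q) : nat := #|supp x|.

Definition hdist n q (x y : word n q) : nat := #|[set i | x i != y i]|.

Definition Jq (n q w : nat) : {set word n q} := [set x | wt x == w].

Definition anticode_in n q (X S : {set word n q}) (D : nat) : Prop :=
  S \subset X /\ S != set0 /\
  (forall x y, x \in S -> y \in S -> hdist x y <= D).

Definition max_anticode_in n q (X S : {set word n q}) (D : nat) : Prop :=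
  anticode_in X S D /\
  (forall B : {set word n q}, anticode_in X B D -> #|B| <= #|S|).

Definition Aprime (n q w t : nat) : {set word n q} :=
  [set x : word n q |
     (#|[set i : 'I_n | (i < t) && (nat_of_ord (x i) != 0)]| == t) &&
     (#|[set i : 'I_n | (t <= i) && (nat_of_ord (x i) != 0)]| == w - t)].

(* Main.v *)
Require Import Defs.
From mathcomp Require Import all_boot.
From mathcomp Require Import zify ring.
Set Implicit Arguments. Unset Strict Implicit. Unset Printing Implicit Defensive.

(** For large q the bound reduces to the exact Erdos-Ko-Rado theorem for
    t-intersecting families of w-sets.  Call a support heavy if it carries more
    than w (q-1)^(w-1) words of the anticode B.  For any word y of B, a heavy
    support F carries a word of B that disagrees with y on all common support
    positions; the distance bound then forces |F n supp y| >= t.  So the heavy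
    supports, together with any one support of B, form a t-intersecting family:
    either every support is heavy, or there are at most C(n-t,w-t) - 1 heavy ones
    and the light ones contribute at most 2^n w (q-1)^(w-1) <= (q-1)^w words.

    The Erdos-Ko-Rado bound (Frankl, Wilson) follows the generating sets of
    Ahlswede and Khachatrian.  A t-intersecting family G of subsets of U is
    weighted by the number of k-sets whose trace on U lies in G, and elements are
    removed from U one at a time, without decreasing the weight, until |U| = t.
    To remove z, first shift G away from z.  Let K be the sets E not in G with
    E + z in G; two members of K with fewer than t common elements cover U - z, so
    their sizes add up to s = |U| + t - 2.  For each pair of sizes e <> d with
    e + d = s keep one size class of K, and for e = d keep only the sets that avoid
    a fixed point x, chosen by averaging. *)

(** * Counting the extensions of a trace *)

(* The number of k-sets with a prescribed e-element trace on a set U that misses m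
   points; the factor guards against the truncated k - e. *)
Definition ext_count (m k e : nat) : nat := (e <= k) * 'C(m, k - e).

Lemma ext_countS m k e :
  ext_count m.+1 k e = ext_count m k e + ext_count m k e.+1.
Proof.
rewrite /ext_count; case: (ltngtP e k) => [ek|ek|->].
- by rewrite !mul1n -(subnSK ek) binS.
- by rewrite !mul0n.
- by rewrite !subnn !bin0 mul0n addn0.
Qed.

Lemma ext_count_rec m k e : e < k ->
  ext_count m k e * (k - e) = ext_count m k e.+1 * (m - (k - e.+1)).
Proof.
move=> ek; rewrite /ext_count ek (ltnW ek) !mul1n -(subnSK ek).
by rewrite mulnC mul_bin_left mulnC.
Qed.

(** From [e] to [e.+1] the count changes by the ratio (k - e) / (m - (k - e.+1)). The hypothesis
    bounds the numerator for [e] by the denominator for [d], and conversely. *)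
Lemma ext_count_mul m k e d : 2 * k <= e + d + m.+1 ->
  ext_count m k e.+1 * ext_count m k d.+1 <= ext_count m k e * ext_count m k d.
Proof.
move=> h.
have [ke|ek] := leqP k e; first by rewrite {1}/ext_count ltnNge ke mul0n.
have [kd|dk] := leqP k d; first by rewrite {2}/ext_count ltnNge kd mul0n muln0.
have p : 0 < (k - e) * (k - d) by rewrite muln_gt0 !subn_gt0 ek dk.
rewrite -(leq_pmul2r p) [leqRHS]mulnACA !ext_count_rec //.
rewrite [leqRHS]mulnACA leq_mul2l; apply/orP; right.
rewrite [leqLHS]mulnC; apply: leq_mul; lia.
Qed.

(* This is where n >= (k-t+1)(t+1) is needed; with r = u - e it reads
   r n >= (k-t+1)(t+2r-1). *)
Lemma ext_count_mid n k t u e :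
  0 < t -> t <= k -> t <= u -> u < n -> (k - t + 1) * (t + 1) <= n ->
  2 * e = u + t - 1 ->
  e * ext_count (n - u.+1) k e.+1 <= (u - e) * ext_count (n - u.+1) k e.
Proof.
move=> t0 tk tu un h s.
have [ke|ek] := leqP k e; first by rewrite {1}/ext_count ltnNge ke mul0n muln0.
have p : 0 < k - e by rewrite subn_gt0.
rewrite -(leq_pmul2r p) -[leqRHS]mulnA ext_count_rec //.
rewrite [leqRHS]mulnCA -mulnA mulnCA leq_mul2l; apply/orP; right.
(* The parameters [t'], [r'] = e - t and [i] turn the differences k - t, u - e and k - e into plain
   sums. *)
have [t' et] : exists t', t = t'.+1 by exists t.-1; lia.
have [r' er] : exists r', e = t' + r'.+1 by exists (e - t); lia.
have [i ei] : exists i, k = e + i.+1 by exists (k - e.+1); lia.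
have eu : u = t' + r'.+1 + r'.+1 by lia.
subst; clear p s tk tu ek t0.
have -> : t' + r'.+1 + r'.+1 - (t' + r'.+1) = r'.+1 by lia.
have -> : t' + r'.+1 + i.+1 - (t' + r'.+1) = i.+1 by lia.
have -> : t' + r'.+1 + i.+1 - (t' + r'.+1).+1 = i by lia.
have h2 : (r' + i + 2) * (t' + 2) <= n by lia.
have h1 : i.+1 * t'.+1 <= n - (t' + r'.+1 + r'.+1).+1 - i.
  have : (r' + i + 2) * (t' + 2) = i.+1 * t'.+1 + r' * t' + (t' + r'.+1 + r'.+1).+1 + i by ring.
  lia.
apply: leq_trans (leq_mul (leqnn r'.+1) h1).
have -> : r'.+1 * (i.+1 * t'.+1) = (t' + r'.+1) * i.+1 + r' * t' * i.+1 by ring.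
exact: leq_addr.
Qed.

(** * Shifting *)

(** The case [E = D] is included, so every member has at least [t] elements. *)
Definition t_intersecting (T : finType) (t : nat) (G : {set {set T}}) : Prop :=
  forall E D, E \in G -> D \in G -> t <= #|E :&: D|.

Definition swap_elt (T : finType) (z x : T) (E : {set T}) := x |: E :\ z.

Definition shiftable (T : finType) (z x : T) (G : {set {set T}}) :=
  [set E in G | [&& z \in E, x \notin E & swap_elt z x E \notin G]].

Definition shift_family (T : finType) (z x : T) (G : {set {set T}}) :=
  (G :\: shiftable z x G) :|: [set swap_elt z x E | E in shiftable z x G].

Section Shift.
Variables (T : finType) (z x : T).
Implicit Types (E D : {set T}) (G : {set {set T}}).

Lemma card_swap_elt E : z \in E -> x \notin E -> #|swap_elt z x E| = #|E|.
Proof.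
move=> zE xE; rewrite /swap_elt cardsU1 !inE (negbTE xE) andbF.
by rewrite (cardsD1 z E) zE.
Qed.

Lemma swap_eltK E : z \in E -> x \notin E -> swap_elt x z (swap_elt z x E) = E.
Proof.
move=> zE xE; apply/setP=> i; rewrite !inE.
case: (eqVneq i z) => [->|iz]; first by rewrite zE.
by case: (eqVneq i x) => [->|ix] //=; rewrite (negbTE xE).
Qed.

Lemma swap_elt_inj G : {in shiftable z x G &, injective (swap_elt z x)}.
Proof.
move=> E D; rewrite !inE => /and4P[_ zE xE _] /and4P[_ zD xD _] eED.
by rewrite -(swap_eltK zE xE) eED swap_eltK.
Qed.

Lemma sum_shift_family G (f : nat -> nat) :
  \sum_(E in shift_family z x G) f #|E| = \sum_(E in G) f #|E|.
Proof.
have sub : shiftable z x G \subset G by apply/subsetP=> E; rewrite inE => /andP[].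
rewrite (eq_bigl [predU G :\: shiftable z x G & [set swap_elt z x E | E in shiftable z x G]]) => [|E]; last by rewrite !inE.
rewrite bigU /=; last first.
  rewrite -setI_eq0; apply/eqP/setP=> E; rewrite [RHS]inE in_setI in_setD.
  apply/negP=> /andP[/andP[_ EG] /imsetP[D]]; rewrite inE => /and4P[_ _ _ nG] e.
  by rewrite -e EG in nG.
rewrite big_imset /=; last exact: swap_elt_inj.
rewrite [RHS](big_setID (shiftable z x G)) /= (setIidPr sub) addnC; congr (_ + _).
by apply: eq_bigr => E; rewrite inE => /and4P[_ zE xE _]; rewrite card_swap_elt.
Qed.

Lemma shift_familyP G E : E \in shift_family z x G ->
  (E \in G /\ (z \in E -> x \notin E -> swap_elt z x E \in G)) \/
  exists D, [/\ D \in G, z \in D, x \notin D & E = swap_elt z x D].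
Proof.
rewrite inE => /orP[|/imsetP[D]].
  rewrite !inE => /andP[n EG]; left; split=> // zE xE.
  by move: n; rewrite EG zE xE /= negbK.
by rewrite inE => /and4P[DG zD xD _] ->; right; exists D.
Qed.

(** The delicate pair is a moved set and a kept set [D] with [z] but not [x]. Such a [D] was kept
    because its own swap lies in [G], and the swap can be transferred from one side of the
    intersection to the other. *)
Lemma shift_t_intersecting t G :
  z != x -> t_intersecting t G -> t_intersecting t (shift_family z x G).
Proof.
move=> zx tG.
have mixed E D : E \in G -> z \in E -> x \notin E -> D \in G ->
    (z \in D -> x \notin D -> swap_elt z x D \in G) ->
    t <= #|swap_elt z x E :&: D|.
  move=> EG zE xE DG hD.
  have [zD|zD] := boolP (z \in D); last first.
    apply: leq_trans (tG _ _ EG DG) _; apply/subset_leq_card/subsetP=> i.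
    rewrite !inE => /andP[iE iD]; rewrite iD iE andbT; apply/orP; right.
    by rewrite andbT; apply: contraNneq zD => <-.
  have [xD|xD] := boolP (x \in D).
    suff -> : swap_elt z x E :&: D = swap_elt z x (E :&: D).
      by rewrite card_swap_elt ?tG // !inE ?zE // (negbTE xE).
    apply/setP=> i; rewrite !inE; case: (eqVneq i x) => [->|_] //=.
    by rewrite andbA.
  suff -> : swap_elt z x E :&: D = E :&: swap_elt z x D by apply: tG => //; exact: hD.
  apply/setP=> i; rewrite !inE; case: (eqVneq i x) => [->|_] /=.
    by rewrite (negbTE xE) (negbTE xD).
  by rewrite andbCA andbA.
move=> E D /shift_familyP[[EG hE]|[E' [EG zE xE ->]]]
  /shift_familyP[[DG hD]|[D' [DG zD xD ->]]].
- exact: tG.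
- by rewrite setIC; exact: mixed.
- exact: mixed.
- suff -> : swap_elt z x E' :&: swap_elt z x D' = swap_elt z x (E' :&: D').
    by rewrite card_swap_elt ?tG // !inE ?zE // (negbTE xE).
  apply/setP=> i; rewrite !inE; case: (eqVneq i x) => [->|_] //=.
  by case: (i != z).
Qed.

(** Termination measure for repeated shifting: moved members lose [z] and none acquires it. *)
Lemma shift_decreases G : z != x -> shiftable z x G != set0 ->
  #|[set E in shift_family z x G | z \in E]| < #|[set E in G | z \in E]|.
Proof.
move=> zx /set0Pn[E0 E0s]; apply: proper_card; apply/properP; split.
  apply/subsetP=> E; rewrite inE => /andP[/shift_familyP[[EG _]|[D [_ _ _ ->]]] zE].
    by rewrite inE EG.
  by move: zE; rewrite !inE (negbTE zx) eqxx.
exists E0; first by move: E0s; rewrite !inE => /and4P[-> ->].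
rewrite inE; apply/negP=> /andP[/shift_familyP[[_ h]|[D [_ _ _ e]]] zE0].
  by move: E0s; rewrite inE => /and4P[_ _ xE0]; rewrite h.
by move: zE0; rewrite e !inE (negbTE zx) eqxx.
Qed.

End Shift.

Lemma exists_shifted (T : finType) t (U : {set T}) (z : T) (G : {set {set T}})
    (f : nat -> nat) :
  z \in U -> t_intersecting t G -> (forall E, E \in G -> E \subset U) ->
  exists G' : {set {set T}},
    [/\ t_intersecting t G', forall E, E \in G' -> E \subset U,
        \sum_(E in G') f #|E| = \sum_(E in G) f #|E| &
        forall E x, E \in G' -> z \in E -> x \in U -> x \notin E ->
          swap_elt z x E \in G'].
Proof.
move=> zU; have [m] := ubnP #|[set E in G | z \in E]|.
elim: m G => // m IH G hm tG subG.
have [/existsP[x /and3P[xU zx ne]]|nosh] :=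
  boolP [exists x, [&& x \in U, z != x & shiftable z x G != set0]].
  have [|||G' [? ? eG' ?]] := IH (shift_family z x G).
  - by rewrite -ltnS in hm; apply: leq_trans (shift_decreases zx ne) _.
  - exact: shift_t_intersecting.
  - move=> E /shift_familyP[[EG _]|[D [DG _ _ ->]]]; first exact: subG.
    apply/subsetP=> i; rewrite !inE => /orP[/eqP->//|/andP[_ iD]].
    exact: (subsetP (subG _ DG)).
  - by exists G'; split=> //; rewrite eG' sum_shift_family.
exists G; split=> // E x EG zE xU xE.
apply/negPn/negP=> nG; case/negP: nosh; apply/existsP; exists x.
rewrite xU /=; apply/andP; split; first by apply: contraNneq xE => <-.
by apply/set0Pn; exists E; rewrite inE EG zE xE.
Qed.

(** * The exact Erdos-Ko-Rado bound *)

(** Keeping size [e] and dropping [d] gains [N e * a e] and costs [N d * b d]. If both choices lost,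
    multiplying the two strict inequalities would contradict the hypothesis. *)
Lemma select_sizes s (N a b : nat -> nat) :
  (forall e d, e + d = s -> b e * b d <= a e * a d) ->
  exists c : nat -> bool, forall e d, e + d = s -> e != d ->
    c d = ~~ c e /\ (c e -> N d * b d <= N e * a e).
Proof.
move=> h; pose good e d := N d * b d <= N e * a e.
(* The smaller size of a pair decides; the larger takes the opposite value. *)
exists (fun e => if 2 * e < s then good e (s - e) else ~~ good (s - e) e) => e d eds ed.
have [ltes|lesd] := boolP (2 * e < s).
  have -> : (2 * d < s) = false by lia.
  have -> : s - d = e by lia.
  by have -> : s - e = d by lia.
have -> : (2 * d < s) = true by lia.
have -> : s - d = e by lia.
have -> : s - e = d by lia.
split; first by rewrite negbK.
rewrite /good -ltnNge => lt1; rewrite leqNgt; apply/negP=> lt2.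
have := ltn_mul lt1 lt2; rewrite mulnACA [X in _ < X -> _]mulnACA ltnNge.
rewrite [N e * N d]mulnC => /negP; apply; apply: leq_mul => //.
by rewrite [leqRHS]mulnC; exact: h.
Qed.

(** Double counting: each [E] misses [#|V| - e] points of [V], and some point is missed at least as
    often as the average. *)
Lemma exists_avoided_point (T : finType) (V : {set T}) (M : {set {set T}}) e :
  0 < #|V| -> (forall E, E \in M -> E \subset V /\ #|E| = e) ->
  exists2 x, x \in V & #|M| * (#|V| - e) <= #|V| * #|[set E in M | x \notin E]|.
Proof.
move=> V0 hM.
have eqS : \sum_(x in V) #|[set E in M | x \notin E]| = #|M| * (#|V| - e).
  transitivity (\sum_(x in V) \sum_(E in M) (x \notin E : nat)).
    apply: eq_bigr => x _; rewrite -sum1_card -big_mkcondr.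
    by apply: eq_bigl => E; rewrite inE.
  rewrite exchange_big /= -sum_nat_const; apply: eq_bigr => E EM.
  have [EV <-] := hM _ EM; rewrite -cardsDS // -sum1_card -big_mkcondr.
  by apply: eq_bigl => x; rewrite inE andbC.
have [/existsP[x /andP[xV hx]]|no] := boolP [exists x, (x \in V) &&
    (#|M| * (#|V| - e) <= #|V| * #|[set E in M | x \notin E]|)]; first by exists x.
have {}no x : x \in V -> #|V| * #|[set E in M | x \notin E]| < #|M| * (#|V| - e).
  by move=> xV; rewrite ltnNge; apply: contra no => h; apply/existsP; exists x; rewrite xV.
have : \sum_(x in V) (#|V| * #|[set E in M | x \notin E]|).+1
    <= \sum_(x in V) #|M| * (#|V| - e) by apply: leq_sum => x /no.
rewrite sum_nat_const (eq_bigr (fun x => #|V| * #|[set E in M | x \notin E]| + 1)).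
  rewrite big_split /= -big_distrr /= eqS sum1_card -[leqRHS]addn0 leq_add2l leqn0 => h.
  by rewrite lt0n h in V0.
by move=> x _; rewrite addn1.
Qed.

Lemma sum_by_card (T : finType) (P : pred {set T}) s (f : nat -> nat) :
  (forall E, P E -> #|E| <= s) ->
  \sum_(E | P E) f #|E| = \sum_(e < s.+1) #|[set E | P E & #|E| == e]| * f e.
Proof.
move=> hs; rewrite (partition_big (fun E : {set T} => inord #|E| : 'I_s.+1) xpredT) //=.
apply: eq_bigr => e _; rewrite -sum_nat_const.
apply: eq_big => E; last first.
  by move=> /andP[PE /eqP <-]; rewrite inordK // ltnS hs.
rewrite inE; case PE: (P E) => //=.
by rewrite -val_eqE /= inordK // ltnS hs.
Qed.

(** * Removing one element from the ground set *)

Section Step.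
Variables (T : finType) (t k : nat) (U : {set T}) (z : T) (G : {set {set T}}).
Hypotheses (zU : z \in U) (t0 : 0 < t) (tk : t <= k) (tU : t < #|U|)
  (nT : (k - t + 1) * (t + 1) <= #|T|).
Hypotheses (tG : t_intersecting t G) (subG : forall E, E \in G -> E \subset U).
Hypothesis shG : forall E x, E \in G -> z \in E -> x \in U -> x \notin E ->
  swap_elt z x E \in G.

Let V := U :\ z.
Let s := #|V| + t - 1.
Let m := #|T| - #|U|.
(** A k-set with trace [E] on [V] has trace [E] or [z |: E] on [U]; [a] and [b] count these two
    kinds. *)
Let a e := ext_count m k e.
Let b e := ext_count m k e.+1.
Let H0 := [set E in G | z \notin E].
Let K := [set E : {set T} | [&& z \notin E, z |: E \in G & E \notin G]].

Let cardU : #|U| = #|V|.+1. Proof. by rewrite /V (cardsD1 z U) zU. Qed.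

Let K_sub E : E \in K -> E \subset V.
Proof.
rewrite inE => /and3P[zE /subG h _]; apply/subsetD1P; split=> //.
exact: subset_trans (subsetUr _ _) h.
Qed.

(** Deleting [z] from the members containing it leaves sets of [H0] or of [K]. A set of [H0] is
    charged [b] even if adding [z] leaves [G], hence the inequality. *)
Let sum_split :
  \sum_(E in G) a #|E| <= \sum_(E in H0) (a #|E| + b #|E|) + \sum_(E in K) b #|E|.
Proof.
pose H1 := [set D : {set T} | (z \notin D) && (z |: D \in G)].
rewrite (bigID (fun E : {set T} => z \in E)) /= addnC big_split /= -addnA.
rewrite (eq_bigl (mem H0)); last by move=> E; rewrite /= inE.
rewrite leq_add2l.
rewrite (eq_bigl (mem [set z |: D | D in H1])); last first.
  move=> E /=; apply/andP/imsetP=> [[EG zE]|[D]].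
    by exists (E :\ z); rewrite ?setD1K // inE setD1K // EG !inE eqxx.
  by rewrite inE => /andP[_ h] ->; rewrite h !inE eqxx.
rewrite big_imset /=; last first.
  move=> D E; rewrite !inE => /andP[zD _] /andP[zE _] h.
  by rewrite -(setU1K zD) h setU1K.
rewrite (eq_bigr (fun D : {set T} => b #|D|)); last first.
  by move=> D; rewrite inE => /andP[zD _]; rewrite cardsU1 zD.
rewrite (bigID (fun D : {set T} => D \in G)) /=; apply: leq_add.
  rewrite [leqLHS]big_mkcond [leqRHS]big_mkcond /=; apply: leq_sum => D _.
  rewrite !inE; case: (D \in G); last by rewrite andbF.
  by case: (z \in D); rewrite //= andbT; case: ifP.
apply: eq_leq; apply: eq_bigl => D; rewrite !inE; by rewrite -andbA.
Qed.

(* Shiftedness forces two such traces to cover V. *)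
Let K_pair E D : E \in K -> D \in K -> #|E :&: D| < t ->
  E :|: D = V /\ #|E| + #|D| = s.
Proof.
move=> EK DK lt.
have := EK; rewrite inE => /and3P[zE EG _].
have := DK; rewrite inE => /and3P[zD DG _].
have cI : #|E :&: D|.+1 = t.
  apply/eqP; rewrite eqn_leq lt /=; apply: leq_trans (tG EG DG) _.
  by rewrite -setUIr cardsU1 !inE (negbTE zE).
have eV : E :|: D = V.
  apply/eqP; rewrite eqEsubset subUset !K_sub //=; apply/subsetP=> x.
  rewrite !inE => /andP[xz xU]; apply/negPn/negP; rewrite negb_or => /andP[xE xD].
  (* Trading [z] for an uncovered [x] would give a member of [G] that meets [z |: D] only in
     [E :&: D]. *)
  have : swap_elt z x (z |: E) \in G.
    by apply: shG; rewrite ?EG ?xU // !inE ?eqxx // negb_or xz.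
  move/(tG)/(_ DG); rewrite leqNgt => /negP; apply.
  suff -> : swap_elt z x (z |: E) :&: (z |: D) = E :&: D by [].
  apply/setP=> i; rewrite !inE.
  case: (eqVneq i x) => [->|_] /=; first by rewrite (negbTE xz) (negbTE xD) andbF.
  by case: (eqVneq i z) => [->|_] //=; rewrite (negbTE zE).
split=> //; have := cardsUI E D; rewrite eV /s; lia.
Qed.

(** The new family is [H0] plus a selected part [L] of [K]. It remains to pay for the [b]-weight of
    the rejected part of [K] with the [a]-weight of [L]. *)
Lemma ekr_step :
  exists G' : {set {set T}},
    [/\ t_intersecting t G', forall E, E \in G' -> E \subset V &
        \sum_(E in G) ext_count (#|T| - #|U|) k #|E| <=
        \sum_(E in G') ext_count (#|T| - #|V|) k #|E|].
Proof.
have UT : #|U| <= #|T| by exact: max_card.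
pose N e := #|[set E in K | #|E| == e]|.
have [c hc] : exists c : nat -> bool, forall e d, e + d = s -> e != d ->
    c d = ~~ c e /\ (c e -> N d * b d <= N e * a e).
  (* Here e + d + m + 1 = [#|T|] + t - 1, which is at least 2k by [nT]. *)
  apply: select_sizes => e d eds; apply: ext_count_mul; rewrite /m; nia.
(* For odd [s] this middle class is empty and any point of [V] serves. *)
pose M := [set E in K | 2 * #|E| == s].
have [||x xV hx] := @exists_avoided_point T V M s./2; first lia.
  by move=> E; rewrite inE => /andP[/K_sub EV /eqP <-]; rewrite mul2n doubleK.
pose sel (E : {set T}) := if 2 * #|E| == s then x \notin E else c #|E|.
have sizes E D : E \in K -> D \in K -> sel E -> sel D -> t <= #|E :&: D|.
  move=> EK DK sE sD; rewrite leqNgt; apply/negP=> /(K_pair EK DK)[eV es].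
  (* Two sets covering [V] cannot both avoid [x], and of two distinct paired sizes [c] keeps only
     one. *)
  have [ed|ed] := eqVneq #|E| #|D|.
    have e2 : 2 * #|D| == s by rewrite -es -ed mul2n addnn.
    move: sE sD; rewrite /sel ed e2 => xE xD.
    by move: xV; rewrite -eV inE (negbTE xE) (negbTE xD).
  have [hcd _] := hc _ _ es ed.
  move: sE sD; rewrite /sel ifN; last by lia.
  by move=> cE; rewrite ifN ?hcd ?cE //; lia.
pose L := [set E in K | sel E].
exists (H0 :|: L); split.
- have H0K E D : E \in H0 -> D \in L -> t <= #|E :&: D|.
    rewrite !inE => /andP[EG zE] /andP[/and3P[zD DG _] _].
    suff -> : E :&: D = E :&: (z |: D) by exact: tG.
    apply/setP=> i; rewrite !inE.
    by case: (eqVneq i z) => [->|_] //=; rewrite (negbTE zE).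
  move=> E D /setUP[E0|EL] /setUP[D0|DL].
  + by move: E0 D0; rewrite !inE => /andP[? _] /andP[? _]; exact: tG.
  + exact: H0K.
  + by rewrite setIC; exact: H0K.
  + by move: EL DL; rewrite inE => /andP[EK sE]; rewrite inE => /andP[DK sD]; exact: sizes.
- move=> E /setUP[]; rewrite inE => /andP[]; last by move=> /K_sub.
  by move=> /subG EU zE; apply/subsetD1P.
have -> : #|T| - #|V| = m.+1 by rewrite /m; lia.
apply: leq_trans sum_split _.
rewrite [leqRHS](eq_bigl [predU H0 & L]) => [|E]; last exact: in_setU.
rewrite bigU /=; last first.
  rewrite disjoint_subset; apply/subsetP=> E; rewrite inE => /andP[EG _].
  by rewrite inE /= inE inE EG !andbF.
rewrite (eq_bigr (fun E : {set T} => ext_count m.+1 k #|E|)); last first.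
  by move=> E _; rewrite ext_countS.
rewrite leq_add2l [leqRHS](eq_bigr (fun E : {set T} => a #|E| + b #|E|)); last first.
  by move=> E _; rewrite ext_countS.
rewrite (bigID sel) /= big_split /= addnC.
rewrite [X in _ + X](eq_bigl (mem L)); last by move=> E; rewrite /= [RHS]inE.
rewrite leq_add2r [leqRHS](eq_bigl (fun E => (E \in K) && sel E)); last first.
  by move=> E; rewrite [LHS]inE.
have Ks E : E \in K -> #|E| <= s.
  by move=> /K_sub/subset_leq_card; rewrite /s; lia.
rewrite (sum_by_card b (s := s)); last by move=> E /andP[/Ks].
rewrite [leqRHS](sum_by_card a (s := s)); last by move=> E /andP[/Ks].
(* Reversal matches the rejected sets of size s - e with the selected sets of size e. *)
rewrite (reindex_inj rev_ord_inj) /=; apply: leq_sum => e _.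
have es : e <= s by rewrite -ltnS.
rewrite subSS; set d := s - e; have ds : e + d = s by rewrite subnKC.
have Nsel (r : nat) (p : {set T} -> bool) (q : bool) :
    (forall E : {set T}, #|E| = r -> p E = q) ->
    #|[set E | (E \in K) && p E & #|E| == r]| = q * N r.
  move=> hp; case: q hp => hp; rewrite ?mul1n ?mul0n.
    apply: eq_card => E; rewrite !inE; case: (eqVneq #|E| r) => h; last by rewrite !andbF.
    by rewrite (hp _ h) !andbT.
  apply/eqP; rewrite cards_eq0; apply/eqP/setP=> E; rewrite !inE.
  by case: (eqVneq #|E| r) => h; rewrite ?andbF // (hp _ h) andbF.
have [ed|ed] := eqVneq (e : nat) d; last first.
  have [hcd hN] := hc _ _ ds ed.
  rewrite (@Nsel d _ (c e)); last by move=> E h; rewrite /sel h ifN ?hcd ?negbK //; lia.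
  rewrite (@Nsel e _ (c e)); last by move=> E h; rewrite /sel h ifN //; lia.
  by case: (c e) hN => // /(_ isT); rewrite !mul1n.
(* In the middle class [A] counts rejected and [B] selected sets. Averaging gives
   [A * (#|V| - e) <= B * e]; with [e * b e <= (#|V| - e) * a e] and e cancelled,
   [A * b e <= B * a e]. *)
rewrite -ed; set A := #|_|; set B := #|_|.
have es2 : s./2 = e by rewrite -[X in X./2]ds -ed addnn doubleK.
have eM (E : {set T}) : (#|E| == e) = (2 * #|E| == s).
  by rewrite -[X in _ = (_ == X)]ds -ed addnn -mul2n eqn_pmul2l.
have eB : B = #|[set E in M | x \notin E]|.
  apply: eq_card => E; rewrite /M 4!in_set eM /sel; clear.
  by case: (2 * _ == s); rewrite ?andbF ?andbT.
have eAB : A + B = #|M|.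
  rewrite eB -[RHS](cardsID [set E : {set T} | x \notin E]) addnC; congr (_ + _).
    by apply: eq_card => E; rewrite in_setI !in_set.
  apply: eq_card => E; rewrite in_setD /M 3!in_set eM /sel; clear.
  by case: (2 * _ == s); rewrite ?andbF ?andbT // andbC.
have mid : e * b e <= (#|V| - e) * a e.
  rewrite /a /b /m cardU; apply: (@ext_count_mid #|T| k t) => //.
  - by rewrite -ltnS -cardU.
  - by rewrite -cardU.
  - by rewrite -/s -[RHS]ds -ed mul2n addnn.
move: hx; rewrite es2 -eB -eAB => hx.
have eV : e <= #|V| by move: ds; rewrite -ed /s; lia.
have [V1 eV1] : exists r, #|V| = e + r by exists (#|V| - e); lia.
have V0 : 0 < #|V| by lia.
move: hx mid V0; rewrite eV1 addKn => hx mid V0.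
have hx' : A * V1 <= B * e by lia.
have e0 : 0 < e by move: ds; rewrite -ed /s; lia.
rewrite -(leq_pmul2r e0).
have h1 : A * (e * b e) <= A * (V1 * a e) by rewrite leq_mul2l mid orbT.
have h2 : A * V1 * a e <= B * e * a e by rewrite leq_mul2r hx' orbT.
lia.
Qed.

End Step.

(** Induction on [#|U|]. Once [#|U| <= t], a member has at least [t] elements, so it can only be [U]
    itself with [#|U| = t]. *)
Lemma ekr_weighted (T : finType) (t k : nat) (U : {set T}) (G : {set {set T}}) :
  0 < t -> t <= k -> (k - t + 1) * (t + 1) <= #|T| ->
  t_intersecting t G -> (forall E, E \in G -> E \subset U) ->
  \sum_(E in G) ext_count (#|T| - #|U|) k #|E| <= 'C(#|T| - t, k - t).
Proof.
move=> t0 tk nT; have [u] := ubnP #|U|; elim: u U G => // u IH U G hu tG subG.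
have [Ut|tU] := leqP #|U| t.
  have GU E : E \in G -> E = U /\ #|U| = t.
    move=> EG; have := tG _ _ EG EG; rewrite setIid => tE.
    have UE : #|U| <= #|E| by exact: leq_trans tE.
    have eEU : E = U by apply/eqP; rewrite eqEcard subG.
    by split=> //; apply/eqP; rewrite eqn_leq Ut -eEU.
  have [->|/set0Pn[E0 /GU[_ eUt]]] := eqVneq G set0; first by rewrite big_set0.
  apply: leq_trans (_ : \sum_(E in [set U]) ext_count (#|T| - #|U|) k #|E| <= _).
    rewrite [leqRHS](bigID (mem G)) /= -[leqLHS]addn0 leq_add //.
    apply: eq_leq; apply: eq_bigl => E; rewrite inE.
    by case: (boolP (E \in G)) => [/GU[-> _]|_]; rewrite ?eqxx ?andbF.
  by rewrite big_set1 eUt /ext_count tk mul1n.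
have /card_gt0P[z zU] : 0 < #|U| by exact: leq_ltn_trans tU.
have [G' [tG' subG' <- shG']] :=
  exists_shifted (ext_count (#|T| - #|U|) k) zU tG subG.
have [G2 [tG2 subG2 le2]] := ekr_step zU t0 tk tU nT tG' subG' shG'.
apply: leq_trans le2 _; apply: IH => //.
by move: hu; rewrite (cardsD1 z U) zU; lia.
Qed.

(** With [U] the whole type a k-set extends only to itself, so every member has weight 1. *)
Theorem erdos_ko_rado (T : finType) (t k : nat) (G : {set {set T}}) :
  0 < t -> t <= k -> (k - t + 1) * (t + 1) <= #|T| ->
  t_intersecting t G -> (forall E, E \in G -> #|E| = k) ->
  #|G| <= 'C(#|T| - t, k - t).
Proof.
move=> t0 tk nT tG Gk.
apply: leq_trans (@ekr_weighted T t k [set: T] G t0 tk nT tG _) => [|E _]; last exact: subsetT.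
rewrite -sum1_card; apply: leq_sum => E /Gk ->.
by rewrite /ext_count leqnn subnn bin0.
Qed.

(** * Words and anticodes *)

Lemma card_bigcup_le (I T : finType) (P : pred I) (A : I -> {set T}) :
  #|\bigcup_(i | P i) A i| <= \sum_(i | P i) #|A i|.
Proof.
elim/big_rec2: _ => [|i c B _ le]; first by rewrite cards0.
by rewrite (leq_trans (leq_card_setU _ _)) // leq_add2l.
Qed.

Lemma prod_if_mem (T : finType) (A : {set T}) (c : nat) :
  \prod_(i : T) (if i \in A then c else 1) = c ^ #|A|.
Proof. by rewrite -big_mkcond prod_nat_const. Qed.

Lemma card_initial_segment n t : t <= n -> #|[set i : 'I_n | i < t]| = t.
Proof. by move=> tn; rewrite cardsE -sum1_card (big_ord_narrow tn) sum1_card card_ord. Qed.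

Section Words.
Variables (n q : nat).
Hypothesis q0 : 0 < q.
Implicit Types (x y : word n q) (F : {set 'I_n}).

Let letter0 : 'I_q := Ordinal q0.

Let letter0P (a : 'I_q) : (nat_of_ord a != 0) = (a != letter0).
Proof. by rewrite -val_eqE. Qed.

Lemma card_words_supp F : #|[set x : word n q | supp x == F]| = (q - 1) ^ #|F|.
Proof.
rewrite -prod_if_mem.
transitivity #|family (fun i : 'I_n => if i \in F then predC1 letter0 else pred1 letter0)|.
  apply: eq_card => x; rewrite inE; apply/eqP/familyP=> [eF i|h].
    rewrite -eF inE letter0P; case: (boolP (x i != letter0)) => h.
      by rewrite inE.
    by rewrite inE; move: h; rewrite negbK.
  apply/setP=> i; rewrite inE letter0P; move: (h i).
  by case: (i \in F); rewrite inE => // /eqP ->; rewrite eqxx.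
rewrite card_family foldrE big_image /=; apply: eq_bigr => i _.
by case: (i \in F); rewrite ?card1 // cardC1 card_ord subn1.
Qed.

(** Zeroing coordinate [i] is injective here, the erased letter being always [c], and leaves support
    [F :\ i]. *)
Lemma card_words_supp_fixed F i (c : 'I_q) : i \in F -> nat_of_ord c != 0 ->
  #|[set x : word n q | (supp x == F) && (x i == c)]| <= (q - 1) ^ #|F|.-1.
Proof.
move=> iF c0; have -> : #|F|.-1 = #|F :\ i| by rewrite (cardsD1 i F) iF.
rewrite -card_words_supp.
pose g (x : word n q) : word n q := [ffun j => if j == i then letter0 else x j].
set X := [set x | _]; have <- : #|g @: X| = #|X|.
  apply: card_in_imset => x y; rewrite !inE => /andP[_ /eqP xi] /andP[_ /eqP yi] /ffunP gxy.
  apply/ffunP=> j; have := gxy j; rewrite !ffunE.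
  by case: (eqVneq j i) => [->|//]; rewrite xi yi.
apply/subset_leq_card/subsetP=> y /imsetP[x]; rewrite {1}/X in_set => /andP[/eqP eF _] ->.
rewrite inE -eF; apply/eqP/setP=> j; rewrite !inE ffunE.
by case: (eqVneq j i).
Qed.

Lemma hdist_le_supp x y : hdist x y <= #|supp x :|: supp y|.
Proof.
apply/subset_leq_card/subsetP=> i; rewrite !inE; apply: contraNT.
rewrite negb_or !negbK => /andP[/eqP xi /eqP yi].
by apply/eqP/val_inj; rewrite /= xi yi.
Qed.

Lemma hdist_disagree x y :
  (forall i, i \in supp x -> i \in supp y -> x i != y i) ->
  hdist x y = #|supp x :|: supp y|.
Proof.
move=> h; apply/eqP; rewrite eqn_leq hdist_le_supp; apply/subset_leq_card/subsetP=> i.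
rewrite !inE => xy; apply/negP=> /eqP e; move: xy; rewrite -e orbb => xi.
by have := h i; rewrite !inE -e xi eqxx => /(_ isT isT).
Qed.

Lemma AprimeE w t : t <= w -> t <= n ->
  Aprime n q w t =
  [set x : word n q | ([set i : 'I_n | i < t] \subset supp x) && (wt x == w)].
Proof.
move=> tw tn; apply/setP=> x; rewrite !inE.
pose I := [set i : 'I_n | i < t].
have cI : #|I| = t by exact: card_initial_segment.
have -> : [set i : 'I_n | (i < t) && (nat_of_ord (x i) != 0)] = I :&: supp x.
  by apply/setP=> i; rewrite !inE.
have -> : [set i : 'I_n | (t <= i) && (nat_of_ord (x i) != 0)] = supp x :\: I.
  by apply/setP=> i; rewrite !inE -leqNgt.
rewrite -/I /wt -(cardsID I (supp x)) [supp x :&: I]setIC.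
have -> : (I \subset supp x) = (#|I :&: supp x| == t).
  rewrite (sameP setIidPl eqP) eqEcard subsetIl /= cI eqn_leq.
  by rewrite -[X in _ = (_ <= X) && _]cI subset_leq_card ?subsetIl.
by case: eqP => //= ->; rewrite -(eqn_add2l t) subnKC.
Qed.

Lemma card_by_supp (P : pred {set 'I_n}) w (B : {set word n q}) :
  (forall x, x \in B = P (supp x) && (wt x == w)) ->
  #|B| = #|[set F : {set 'I_n} | P F & #|F| == w]| * (q - 1) ^ w.
Proof.
move=> hB; rewrite -sum1_card (partition_big (@supp n q) (fun F => P F && (#|F| == w))) /=.
  rewrite -sum_nat_const; apply: eq_big => [F|F /andP[PF /eqP Fw]]; first by rewrite inE.
  rewrite sum1_card -Fw -card_words_supp; apply: eq_card => x.
  rewrite [LHS]inE [RHS]inE hB.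
  by rewrite /wt; case: (supp x =P F) => [->|_]; rewrite ?andbF // PF Fw eqxx.
by move=> x; rewrite hB.
Qed.

End Words.

Lemma card_supersets (T : finType) (I : {set T}) w : #|I| <= w ->
  #|[set F : {set T} | I \subset F & #|F| == w]| = 'C(#|T| - #|I|, w - #|I|).
Proof.
move=> Iw; have cI : #|~: I| = #|T| - #|I| by rewrite cardsCs setCK.
rewrite -cI -cards_draws.
set X := [set A : {set T} | A \subset ~: I & _]; have <- : #|[set F :|: I | F in X]| = #|X|.
  apply: card_in_imset => F D; rewrite !inE => /andP[FI _] /andP[DI _] /= e.
  have FK (F' : {set T}) : F' \subset ~: I -> (F' :|: I) :\: I = F'.
    by rewrite setDUl setDv setU0 setDE => /setIidPl.
  by rewrite -(FK F) // e FK.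
apply: eq_card => F; apply/idP/imsetP=> [|[D]].
  rewrite inE => /andP[IF /eqP Fw]; exists (F :\: I); last first.
    by rewrite setUC -{1}(setIidPr IF) setID.
  by rewrite /X in_set cardsDS // Fw eqxx andbT subDset setUCr subsetT.
rewrite {1}/X in_set => /andP[DI /eqP cD] ->; rewrite inE subsetUr cardsU cD.
have -> : D :&: I = set0 by apply/eqP; rewrite setI_eq0 disjoints_subset.
by rewrite cards0 subn0 subnK // eqxx.
Qed.

(** * The sets A' as anticodes *)

Section MaximumAnticodes.
Variables (n w t : nat).
Hypotheses (tw : t <= w) (wn : 2 * w - t <= n).

Lemma card_Aprime q : 0 < q -> #|Aprime n q w t| = 'C(n - t, w - t) * (q - 1) ^ w.
Proof.
move=> q0; have tn : t <= n by lia.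
have cI := card_initial_segment tn.
rewrite (@card_by_supp _ _ q0 (fun F => [set i : 'I_n | i < t] \subset F) w); last first.
  by move=> x; rewrite AprimeE // inE.
by rewrite card_supersets ?cI ?card_ord.
Qed.

Lemma anticode_Aprime q : 1 < q ->
  anticode_in (Jq n q w) (Aprime n q w t) (2 * w - t).
Proof.
move=> q1; have q0 : 0 < q by lia.
have tn : t <= n by lia.
have cI := card_initial_segment tn.
split; [|split].
- by rewrite AprimeE //; apply/subsetP=> x; rewrite !inE => /andP[].
- by rewrite -card_gt0 card_Aprime // muln_gt0 expn_gt0 bin_gt0 subn_gt0 q1; lia.
- move=> x y; rewrite AprimeE // !inE => /andP[tx /eqP wx] /andP[ty /eqP wy].
  apply: leq_trans (hdist_le_supp x y) _.
  (* Both supports contain the first [t] coordinates. *)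
  have : t <= #|supp x :&: supp y|.
    by rewrite -[X in X <= _]cI subset_leq_card // subsetI tx.
  by rewrite cardsU -/(wt x) -/(wt y) wx wy; lia.
Qed.

(** * The upper bound over a large alphabet *)

Section LargeAlphabet.
Variables (q : nat) (B : {set word n q}).
Hypotheses (t0 : 0 < t) (q0 : 0 < q) (large : 2 ^ n * w <= q - 1)
  (nw : (w - t + 1) * (t + 1) <= n)
  (BJ : B \subset Jq n q w)
  (dB : forall x y, x \in B -> y \in B -> hdist x y <= 2 * w - t).

Let fibre (F : {set 'I_n}) := [set x in B | supp x == F].
Let heavy := [set F : {set 'I_n} | w * (q - 1) ^ w.-1 < #|fibre F|].

Let wtB x : x \in B -> #|supp x| = w.
Proof. by move/(subsetP BJ); rewrite inE => /eqP. Qed.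

(** The distance is then the size of the union of the supports, 2w minus that of their
    intersection. *)
Let disagree_meet x y : x \in B -> y \in B ->
  (forall i, i \in supp x -> i \in supp y -> x i != y i) ->
  t <= #|supp x :&: supp y|.
Proof.
move=> xB yB /hdist_disagree e; have := dB xB yB.
have := subset_leq_card (subsetIl (supp x) (supp y)).
by rewrite e cardsU !wtB //; lia.
Qed.

(* Words with support F agreeing somewhere with y number at most w (q-1)^(w-1),
   so some word with support F disagrees with y everywhere. *)
Let heavy_meet F y : F \in heavy -> y \in B -> t <= #|F :&: supp y|.
Proof.
rewrite inE => hF yB.
have [/existsP[x /and3P[xB /eqP <- /forallP h]]|no] := boolP [exists x : word n q,
    [&& x \in B, supp x == F & [forall i, (i \in supp x :&: supp y) ==> (x i != y i)]]].
  apply: disagree_meet => // i ix iy.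
  by have := h i; rewrite inE ix iy.
have Fw : #|F| = w.
  have /card_gt0P[x] : 0 < #|fibre F| by exact: leq_ltn_trans hF.
  by rewrite inE => /andP[/wtB xw /eqP <-].
have sub : fibre F \subset
    \bigcup_(i in F :&: supp y) [set x : word n q | (supp x == F) && (x i == y i)].
  apply/subsetP=> x; rewrite inE => /andP[xB /eqP xF].
  move: no; rewrite negb_exists => /forallP/(_ x).
  rewrite xB xF eqxx /= negb_forall => /existsP[i].
  rewrite negb_imply negbK => /andP[iI xy].
  by apply/bigcupP; exists i => //; rewrite inE xF eqxx.
suff : #|fibre F| <= w * (q - 1) ^ w.-1 by rewrite leqNgt hF.
apply: leq_trans (subset_leq_card sub) _.
apply: leq_trans (card_bigcup_le _ _) _.
apply: leq_trans (_ : \sum_(i in F :&: supp y) (q - 1) ^ w.-1 <= _).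
  apply: leq_sum => i; rewrite inE => /andP[iF]; rewrite inE => yi.
  by rewrite -Fw; exact: card_words_supp_fixed.
by rewrite sum_nat_const leq_mul2r -{2}Fw subset_leq_card ?subsetIl ?orbT.
Qed.

Let heavy_supp F : F \in heavy -> exists2 x, x \in B & supp x = F.
Proof.
rewrite inE => hF; have /card_gt0P[x] : 0 < #|fibre F| by exact: leq_ltn_trans hF.
by rewrite inE => /andP[xB /eqP xF]; exists x.
Qed.

Let ekr (G : {set {set 'I_n}}) :
  t_intersecting t G -> (forall E, E \in G -> #|E| = w) -> #|G| <= 'C(n - t, w - t).
Proof. by move=> tG Gw; have := erdos_ko_rado t0 tw _ tG Gw; rewrite card_ord; apply. Qed.

Lemma anticode_bound : #|B| <= 'C(n - t, w - t) * (q - 1) ^ w.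
Proof.
have w0 : 0 < w by exact: leq_trans tw.
have eB : #|B| = \sum_F #|fibre F|.
  rewrite -sum1_card (partition_big (@supp n q) xpredT) //=.
  by apply: eq_bigr => F _; rewrite sum1_card; apply: eq_card => x; rewrite [RHS]inE.
have fib_le F : #|fibre F| <= (q - 1) ^ w.
  have [->|/set0Pn[x]] := eqVneq (fibre F) set0; first by rewrite cards0.
  rewrite inE => /andP[/wtB xw /eqP xF]; rewrite -xw xF -card_words_supp //.
  by apply/subset_leq_card/subsetP=> y; rewrite !inE => /andP[].
have tH : t_intersecting t heavy.
  by move=> E D EH /heavy_supp[y yB <-]; exact: heavy_meet.
have Hw E : E \in heavy -> #|E| = w by move=> /heavy_supp[x /wtB xw <-].
have sumH : \sum_(F in heavy) #|fibre F| <= #|heavy| * (q - 1) ^ w.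
  by rewrite -sum_nat_const; apply: leq_sum.
have [/existsP[y /andP[yB yH]]|all_heavy] := boolP [exists y in B, supp y \notin heavy].
  (* Adding the light support of [y] keeps the family t-intersecting, so one spare term (q-1)^w
     remains to pay for all light supports. *)
  have cH : #|heavy|.+1 <= 'C(n - t, w - t).
    have <- : #|supp y |: heavy| = #|heavy|.+1 by rewrite cardsU1 yH.
    apply: ekr => [E D|E] /setU1P[->|EH].
    + move=> /setU1P[->|DH]; first by rewrite setIid wtB.
      by rewrite setIC; exact: heavy_meet.
    + by move=> /setU1P[->|DH]; [exact: heavy_meet|exact: tH].
    + exact: wtB.
    + exact: Hw.
  apply: leq_trans (leq_mul cH (leqnn _)).
  rewrite eB (bigID (mem heavy)) /= mulSn addnC leq_add //.
  (* There are at most 2^n light supports, and [large] absorbs the factor 2^n w into one power of q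
     - 1. *)
  apply: leq_trans (_ : \sum_(F : {set 'I_n}) w * (q - 1) ^ w.-1 <= _).
    rewrite big_mkcond /=; apply: leq_sum => F _.
    by case: ifP => //; rewrite inE -leqNgt.
  rewrite sum_nat_const -cardsT -powersetT card_powerset cardsT card_ord mulnA.
  by rewrite -[X in _ <= _ ^ X](prednK w0) expnS leq_mul2r large orbT.
rewrite eB (bigID (mem heavy)) /= [X in _ + X]big1 ?addn0 => [|F nH]; last first.
  apply/eqP; rewrite cards_eq0; apply/eqP/setP=> x; rewrite !inE.
  apply/negP=> /andP[xB /eqP xF]; case/negP: all_heavy.
  by apply/existsP; exists x; rewrite xB xF.
by apply: leq_trans sumH _; rewrite leq_mul2r ekr ?orbT.
Qed.

End LargeAlphabet.
End MaximumAnticodes.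

Theorem mainTheorem3 (n w t : nat) :
  t <= w -> t <= 2 * w - t -> 2 * w - t <= n ->
  (forall q : nat, 3 <= q ->
     #|Aprime n q w t| = 'C(n - t, w - t) * (q - 1) ^ w /\
     anticode_in (Jq n q w) (Aprime n q w t) (2 * w - t)) /\
  ((w - t + 1) * (t + 1) <= n ->
     exists Q : nat, forall q : nat, 3 <= q -> Q <= q ->
       max_anticode_in (Jq n q w) (Aprime n q w t) (2 * w - t)).
Proof.
move=> tw _ wn; split=> [q q3|nw].
  have q1 : 1 < q by exact: leq_trans q3.
  by split; [apply: card_Aprime => //; exact: ltnW|exact: anticode_Aprime].
(* This is exactly 2^n w <= q - 1, the hypothesis [large]. *)
exists (2 ^ n * w + 1) => q q3 qQ.
have q1 : 1 < q by exact: leq_trans q3.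
have q0 := ltnW q1.
split=> [|B [BJ [_ dB]]]; first exact: anticode_Aprime.
(* For t = 0 the set A' is all of [Jq n q w]; the Erdos-Ko-Rado argument takes t > 0. *)
have [t0|t0] := posnP t.
  apply/subset_leq_card/(subset_trans BJ)/subsetP=> x.
  by rewrite AprimeE ?t0 // !inE => ->; rewrite andbT; apply/subsetP=> i; rewrite inE.
rewrite card_Aprime //; apply: anticode_bound => //; lia.
Qed.
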